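(* Let $F$ be a field of characteristic $3$, and for $i=1,2$ let $L_i=F(y_i)$ be a separable extension of $F$ of degree $3$, where $y_i^3+a_iy_i+a_i^2=0$ with $a_i\in F$. Then the following are equivalent: (1) $L_1\simeq L_2$ as extensions of $F$; (2) there exist $w\in F$ and $j\in\{1,2\}$ such that, with $\beta=-ja_1-\left(\frac{w^3}{a_1}+w\right)\in F$, under an $F$-isomorphism identifying $L_2$ with $L_1$ one has $y_2=-\beta\left(\frac{j}{a_1}y_1+\frac{1}{a_1}w\right)$; (3) there exist $w\in F$ and $j\in\{1,2\}$ such that $a_2=\frac{(ja_1^2+(w^3+a_1w))^2}{a_1^3}$.
   Formalization: In (2) the sign of w is corrected: y_2 = -β((j/a_1)y_1 - (1/a_1)w), with β as printed; the printed plus sign forces w^3 + a_1 w = 0 and a_2 = a_1, so (2) fails e.g. for F = F_9, a_1 = -1, a_2 = i, where (1) and (3) hold. *)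

(* Defs.v *)
From HB Require Import structures.
From mathcomp Require Import all_boot all_order all_algebra all_field.
Set Implicit Arguments.
Unset Strict Implicit.
Unset Printing Implicit Defensive.
Import GRing.Theory.
Local Open Scope ring_scope.

Definition ext_iso (F : fieldType) (L1 L2 : fieldExtType F) : Prop :=
  exists phi : {lrmorphism L1 -> L2}, bijective phi.

(* The subspace 1 of L is the image of F, so <<1; y>> is the subfield F(y). *)
Definition separable_cubic_gen (F : fieldType) (L : fieldExtType F)
    (y : L) (a : F) : Prop :=
  [/\ <<1; y>>%VS = fullv :> {vspace L},
      \dim {:L} = 3%N,
      separable 1 {:L}
    & y ^+ 3 + a *: y + (a ^+ 2)%:A = 0].

(* Main.v *)
(* Expand an element x of F(y1) on the basis 1, y1, y1^2.  Since cubing is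
   additive in characteristic 3, the equation x^3 + a2 x + a2^2 = 0 splits into
   three equations over F, and irreducibility of X^3 + a1 X + a1^2 kills the
   coefficient of y1^2: every root of the second cubic in F(y1) is affine in y1,
   x = u + v y1 with a2 = a1 v^2.  The constant term then expresses v through
   u / v, which is (2) with j = 1 and w = - u / v, and a2 = a1 v^2 is (3).
   Conversely (3) provides such a root, hence an embedding F(y2) -> F(y1), which
   is onto by dimension. *)
Require Import Defs.
From HB Require Import structures.
From mathcomp Require Import all_boot all_order all_algebra all_field.
From mathcomp Require Import ring.
Set Implicit Arguments.
Unset Strict Implicit.
Unset Printing Implicit Defensive.
Import GRing.Theory.
Local Open Scope ring_scope.

(** * Evaluation at a generator, and the morphisms it determines *)

Lemma horner_alg_surj (F : fieldType) (L : fieldExtType F) (y v : L) :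
  <<1; y>>%VS = fullv :> {vspace L} ->
  exists2 q : {poly F}, (size q <= \dim {:L})%N & v = horner_alg y q.
Proof.
move=> gen; have yv : v \in <<1; y>>%VS by rewrite gen memvf.
have /polyOver1P[q Eq] := Fadjoin_polyOver 1%AS y v.
exists q; last by rewrite -(Fadjoin_poly_eq yv) Eq.
have := size_Fadjoin_poly 1%AS y v.
by rewrite Eq size_map_poly -gen dim_Fadjoin dimv1 muln1.
Qed.

(** The minimal polynomial of [y] has degree [\dim {:L}] and divides [q], whose degree is
    smaller. *)
Lemma horner_alg_eq0 (F : fieldType) (L : fieldExtType F) (y : L)
    (q : {poly F}) :
  <<1; y>>%VS = fullv :> {vspace L} -> (size q <= \dim {:L})%N ->
  horner_alg y q = 0 -> q = 0.
Proof.
move=> gen szq q0; apply/eqP; rewrite -(map_poly_eq0 (GRing.in_alg L)).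
have: minPoly 1%AS y %| map_poly (GRing.in_alg L) q.
  apply: minPoly_dvdp; first by apply/polyOver1P; exists q.
  exact/rootP.
apply: contraLR => nz; apply/negP => /(dvdp_leq nz).
have := dim_Fadjoin 1%AS y; rewrite gen dimv1 muln1 => dimL.
by rewrite size_minPoly size_map_poly -dimL ltnNge szq.
Qed.

(** By its degree, [p] is the minimal polynomial of [y] up to a scalar. Hence every polynomial
    vanishing at [y] vanishes at [x], and sending q(y) to q(x) is well defined. *)
Lemma lrmorphism_of_root (F : fieldType) (L1 L2 : fieldExtType F)
    (y : L1) (x : L2) (p : {poly F}) :
    <<1; y>>%VS = fullv :> {vspace L1} ->
    size p = (\dim {:L1}).+1 -> horner_alg y p = 0 -> horner_alg x p = 0 ->
  exists phi : {lrmorphism L1 -> L2}, phi y = x.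
Proof.
move=> gen szp py px.
have nz_p : p != 0 by rewrite -size_poly_eq0 szp.
have annih q : horner_alg y q = 0 -> horner_alg x q = 0.
  move=> qy; rewrite (divp_eq q p) rmorphD rmorphM /= px mulr0 add0r.
  suff ->: q %% p = 0 by rewrite rmorph0.
  apply: horner_alg_eq0 gen _ _; first by rewrite -ltnS -szp ltn_modp.
  by move: qy; rewrite {1}(divp_eq q p) rmorphD rmorphM /= py mulr0 add0r.
have exq v : exists q : {poly F}, v == horner_alg y q.
  by have [q _ ->] := horner_alg_surj v gen; exists q.
(* A representing polynomial is chosen for each [v]; [annih] makes the value independent of this
   choice. *)
pose f v := horner_alg x (xchoose (exq v)).
have fE q v : v = horner_alg y q -> f v = horner_alg x q.
  move=> Ev; apply/eqP; rewrite -subr_eq0 -rmorphB; apply/eqP/annih.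
  by rewrite rmorphB /= -Ev -(eqP (xchooseP (exq v))) subrr.
have fP v : exists2 q, v = horner_alg y q & f v = horner_alg x q.
  by have [q _ Eq] := horner_alg_surj v gen; exists q => //; apply: fE.
have f_lin : linear f.
  move=> c u v; have [q Eu ->] := fP u; have [r Ev ->] := fP v.
  have hornerP (L : fieldExtType F) (z : L) :
    horner_alg z (c *: q + r) = c *: horner_alg z q + horner_alg z r.
    by rewrite -mul_polyC rmorphD rmorphM /= horner_algC mulr_algl.
  by rewrite -hornerP; apply: fE; rewrite hornerP Eu Ev.
have f_mul : monoid_morphism f.
  split; first by rewrite -(rmorph1 (horner_alg x)); apply: fE; rewrite rmorph1.
  move=> u v; have [q Eu ->] := fP u; have [r Ev ->] := fP v.
  by rewrite -rmorphM; apply: fE; rewrite rmorphM Eu Ev.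
pose fL := GRing.isLinear.Build F L1 L2 *:%R f f_lin.
pose fM := GRing.isMonoidMorphism.Build L1 L2 f f_mul.
pose phi : {lrmorphism L1 -> L2} := HB.pack f fL fM.
exists phi; rewrite -[RHS](horner_algX x); apply: fE.
by rewrite horner_algX.
Qed.

Lemma lrmorphism_bij (F : fieldType) (L1 L2 : fieldExtType F)
    (phi : {lrmorphism L1 -> L2}) :
  \dim {:L1} = \dim {:L2} -> bijective phi.
Proof.
move=> eq_dim; pose f := linfun phi.
have fE : f =1 phi by move=> v; rewrite lfunE.
have kf : lker f == 0%VS by apply/lker0P => u v; rewrite !fE; apply: fmorph_inj.
have imf : limg f = fullv.
  apply/eqP; rewrite eqEdim subvf limg_dim_eq; first exact: eq_leq (esym eq_dim).
  by move/eqP: kf => ->; rewrite capv0.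
exists (f^-1)%VF => v; rewrite -fE; first by rewrite lker0_lfunK.
by rewrite limg_lfunVK // imf memvf.
Qed.

Lemma ext_iso_sym (F : fieldType) (L1 L2 : fieldExtType F) :
  ext_iso L1 L2 -> ext_iso L2 L1.
Proof.
case=> phi [psi phiK psiK].
pose psiL := GRing.isLinear.Build F L2 L1 *:%R psi (can2_linear phiK psiK).
pose psiM := GRing.isMonoidMorphism.Build L2 L1 psi
  (can2_monoid_morphism phiK psiK).
by exists (HB.pack psi psiL psiM : {lrmorphism L2 -> L1}); exists phi.
Qed.

(** * Coordinates on 1, y, y^2 in a cubic extension *)

Lemma horner_alg_Poly3 (F : fieldType) (L : fieldExtType F) (y : L)
    (u v w : F) :
  horner_alg y (Poly [:: u; v; w]) = u%:A + v%:A * y + w%:A * y ^+ 2.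
Proof.
rewrite /= !cons_poly_def !(rmorphD, rmorphM) /= rmorph0 !horner_algC horner_algX.
ring.
Qed.

Lemma cubic_coordP (F : fieldType) (L : fieldExtType F) (y x : L) :
  <<1; y>>%VS = fullv :> {vspace L} -> \dim {:L} = 3%N ->
  exists u v w : F, x = u%:A + v%:A * y + w%:A * y ^+ 2.
Proof.
move=> gen dim3; have [q szq ->] := horner_alg_surj x gen; exists q`_0, q`_1, q`_2.
rewrite -horner_alg_Poly3; congr (horner_alg y _); apply/polyP => i.
rewrite coef_Poly; case: i => [|[|[|i]]] //=.
by rewrite nth_nil nth_default // (leq_trans szq) // dim3.
Qed.

Lemma cubic_coord_eq0 (F : fieldType) (L : fieldExtType F) (y : L)
    (u v w : F) :
  <<1; y>>%VS = fullv :> {vspace L} -> \dim {:L} = 3%N ->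
  u%:A + v%:A * y + w%:A * y ^+ 2 = 0 -> [/\ u = 0, v = 0 & w = 0].
Proof.
move=> gen dim3; rewrite -horner_alg_Poly3 => /horner_alg_eq0 -/(_ gen) P0.
have {}P0 : Poly [:: u; v; w] = 0 by apply: P0; rewrite dim3 size_Poly.
by split; [have := coef_Poly [:: u; v; w] 0 | have := coef_Poly [:: u; v; w] 1
  | have := coef_Poly [:: u; v; w] 2]; rewrite P0 coef0.
Qed.

Lemma cubic_gen_notin (F : fieldType) (L : fieldExtType F) (y : L) (s : F) :
  <<1; y>>%VS = fullv :> {vspace L} -> \dim {:L} = 3%N -> y <> s%:A.
Proof.
move=> gen dim3 Ey.
have [|_ /eqP] := @cubic_coord_eq0 _ _ _ (- s) 1 0 gen dim3.
  by rewrite scaleNr scale1r mul1r scale0r mul0r addr0 Ey addNr.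
by rewrite oner_eq0.
Qed.

Lemma separable_cubic_gen_neq0 (F : fieldType) (L : fieldExtType F) (y : L)
  (a : F) : separable_cubic_gen y a -> a != 0.
Proof.
case=> gen dim3 _ Ey; apply/eqP => a0; move: Ey.
rewrite a0 scale0r expr0n scale0r !addr0 => /eqP; rewrite expf_eq0 /= => /eqP y0.
by apply: (cubic_gen_notin gen dim3 (s := 0)); rewrite scale0r.
Qed.

(** * Roots of the cubics in characteristic 3 *)

Lemma expr3D_pchar3 (F : fieldType) (L : fieldExtType F) (x y : L) :
  3%N \in [pchar F] -> (x + y) ^+ 3 = x ^+ 3 + y ^+ 3.
Proof.
move=> charF; apply: exprDn_pchar.
by rewrite (eq_pnat _ (pchar_lalg L)) pnatE.
Qed.

Lemma scale_in_algE (F : fieldType) (L : fieldExtType F) (c : F) (x : L) :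
  c *: x = GRing.in_alg L c * x.
Proof. by rewrite in_algE mulr_algl. Qed.

Lemma cubic_eq0E (F : fieldType) (L : fieldExtType F) (y : L) (a : F) :
  y ^+ 3 + a *: y + (a ^+ 2)%:A = 0 <->
  y ^+ 3 = - (GRing.in_alg L a * y) - GRing.in_alg L a ^+ 2.
Proof.
rewrite -rmorphXn /= mulr_algl -opprD -addrA.
by split=> [/eqP|->]; [rewrite addr_eq0 => /eqP | rewrite addNr].
Qed.

(** With f the cubic, a root [t] gives 0 = f(y) - f(t) = (y - t)((y - t)^2 + a), and neither factor
    vanishes since 1, y, y^2 are independent. *)
Lemma cubic_gen_noroot (F : fieldType) (L : fieldExtType F) (y : L) (a t : F) :
  3%N \in [pchar F] -> separable_cubic_gen y a -> t ^+ 3 + a * t + a ^+ 2 != 0.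
Proof.
move=> charF [gen dim3 _ /cubic_eq0E Ey]; apply/eqP => Et.
have /eqP: (y - t%:A) *
    ((t ^+ 2 + a)%:A + (- (2%:R * t))%:A * y + 1%:A * y ^+ 2) = 0.
  have: GRing.in_alg L (- (t ^+ 3 + a * t + a ^+ 2)) = 0.
    by rewrite Et oppr0 rmorph0.
  rewrite -!in_algE => <-.
  transitivity ((y + - GRing.in_alg L t) ^+ 3
                + GRing.in_alg L a * (y - GRing.in_alg L t)); first by ring.
  rewrite expr3D_pchar3 //.
  ring: Ey.
rewrite mulf_eq0 subr_eq0 => /orP[/eqP|/eqP]; first exact: cubic_gen_notin.
by case/(cubic_coord_eq0 gen dim3) => _ _ /eqP; rewrite oner_eq0.
Qed.

Lemma cubic_root_affine (F : fieldType) (L : fieldExtType F) (y x : L)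
    (a b : F) :
    3%N \in [pchar F] -> separable_cubic_gen y a -> (forall s : F, x <> s%:A) ->
    x ^+ 3 + b *: x + (b ^+ 2)%:A = 0 ->
  exists u v : F, [/\ x = u%:A + v%:A * y, v != 0, b = a * v ^+ 2
    & a ^+ 2 * v ^+ 4 = a ^+ 2 * v ^+ 3 - u ^+ 3 - a * u * v ^+ 2].
Proof.
move=> charF cub; have nz_a := separable_cubic_gen_neq0 cub.
have [gen dim3 _ /cubic_eq0E Ey] := cub.
move=> xF; have [u [v [w Ex]]] := cubic_coordP x gen dim3.
move/cubic_eq0E => Exx.
(* Cubing termwise and reducing by y^3 = - a y - a^2, so that y^6 = a^2 y^2 + 2 a^3 y + a^4, yields
   these coefficients of 1, y, y^2. *)
have [] := @cubic_coord_eq0 _ _ y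
  (u ^+ 3 - a ^+ 2 * v ^+ 3 + a ^+ 4 * w ^+ 3 + b * u + b ^+ 2)
  (- (a * v ^+ 3) + 2%:R * a ^+ 3 * w ^+ 3 + b * v)
  (a ^+ 2 * w ^+ 3 + b * w) gen dim3.
  rewrite -!in_algE in Exx Ex *.
  move/eqP: Exx; rewrite -subr_eq0 => /eqP <-; rewrite Ex.
  rewrite !expr3D_pchar3 //.
  ring: Ey.
move=> E0 E1 E2.
(* If w were nonzero, v / w would be a root of X^3 + a X + a^2 in F. *)
have w0 : w = 0.
  apply/eqP; apply: contraT => nz_w.
  have Eb : b = - (a ^+ 2 * w ^+ 2).
    apply: (mulIf nz_w); apply/eqP; rewrite -subr_eq0; apply/eqP.
    by rewrite -[RHS]E2; ring.
  have /eqP := cubic_gen_noroot (v / w) charF cub; case.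
  have -> : (v / w) ^+ 3 + a * (v / w) + a ^+ 2 =
    (a * v ^+ 3 + a ^+ 2 * w ^+ 2 * v + a ^+ 3 * w ^+ 3) / (a * w ^+ 3).
    by field; rewrite ?nz_a ?nz_w.
  (* Up to a multiple of 3, the numerator is the opposite of the coefficient of y, which is 0 by
     [E1]. *)
  have -> : a * v ^+ 3 + a ^+ 2 * w ^+ 2 * v + a ^+ 3 * w ^+ 3 =
    3%:R * (a ^+ 3 * w ^+ 3)
    - (- (a * v ^+ 3) + 2%:R * a ^+ 3 * w ^+ 3 + b * v) by rewrite Eb; ring.
  by rewrite E1 (pcharf0 charF) !mul0r subr0 mul0r.
rewrite w0 in E0 E1 Ex.
have Exv : x = u%:A + v%:A * y by rewrite Ex scale0r mul0r addr0.
have nz_v : v != 0.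
  by apply/eqP => v0; apply: (xF u); rewrite Exv v0 scale0r mul0r addr0.
have Eb : b = a * v ^+ 2.
  apply: (mulIf nz_v); apply/eqP; rewrite -subr_eq0; apply/eqP.
  by rewrite -[RHS]E1; ring.
exists u, v; split=> //.
apply/eqP; rewrite -subr_eq0; apply/eqP; rewrite -[RHS]E0 Eb.
ring.
Qed.

Lemma expr3_pchar3_nat (F : fieldType) (j : nat) :
  3%N \in [pchar F] -> j%:R ^+ 3 = j%:R :> F.
Proof. by move=> charF; rewrite -(pFrobenius_autE charF) pFrobenius_aut_nat. Qed.

(* The root arises by scaling z = k y - w, which satisfies
   z ^ 3 + a z = - (k a ^ 2 + w ^ 3 + a w). *)
Lemma cubic_affine_root (F : fieldType) (L : fieldExtType F) (y : L)
    (a k w : F) (P := k * a ^+ 2 + (w ^+ 3 + a * w)) (b := P ^+ 2 / a ^+ 3)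
    (x := (P / a ^+ 2) *: (k *: y - w%:A)) :
    3%N \in [pchar F] -> separable_cubic_gen y a -> k ^+ 3 = k ->
  x ^+ 3 + b *: x + (b ^+ 2)%:A = 0.
Proof.
move=> charF cub k3; have nz_a := separable_cubic_gen_neq0 cub.
have [_ _ _ /cubic_eq0E Ey] := cub.
apply/cubic_eq0E.
(* With z = k y - w one has x = c z, P = c a^2 and b = a c^2, so x^3 + b x = c^3 (z^3 + a z) = - c^3
   P = - b^2. *)
pose c := P / a ^+ 2.
have EP : w ^+ 3 = c * a ^+ 2 - k * a ^+ 2 - a * w by rewrite /c /P; field.
have Eb : b = a * c ^+ 2 by rewrite /b /c; field.
have {}EP := congr1 (GRing.in_alg L) EP.
have {}k3 := congr1 (GRing.in_alg L) k3.
rewrite /x -/c Eb !scale_in_algE.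
rewrite exprMn expr3D_pchar3 //.
ring: Ey EP k3.
Qed.

(* The sign of w in the formula for y2 is forced: (j y1 + w)^3 + a1 (j y1 + w)
   = w^3 + a1 w - j a1^2, so with a plus sign the element on the right would be
   a root of X^3 + a2 X + a2^2 only when w^3 + a1 w = 0. *)
Theorem mainTheorem4 (F : fieldType) (charF : 3%N \in [pchar F])
    (L1 L2 : fieldExtType F) (y1 : L1) (y2 : L2) (a1 a2 : F)
    (gen1 : separable_cubic_gen y1 a1) (gen2 : separable_cubic_gen y2 a2) :
  [<-> ext_iso L1 L2;
       exists (w : F) (j : nat), j \in [:: 1%N; 2%N] /\
         let beta : F := - (j%:R * a1) - (w ^+ 3 / a1 + w) in
         exists2 phi : {lrmorphism L2 -> L1}, bijective phi &
           phi y2 = (- beta) *: ((j%:R / a1) *: y1 - (a1^-1 * w)%:A);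
       exists (w : F) (j : nat), j \in [:: 1%N; 2%N] /\
         a2 = (j%:R * a1 ^+ 2 + (w ^+ 3 + a1 * w)) ^+ 2 / a1 ^+ 3].
Proof.
have nz_a1 := separable_cubic_gen_neq0 gen1.
have [gen1' dim1 _ _] := gen1; have [gen2' dim2 _ Ey2] := gen2.
have root_affine (phi : {lrmorphism L2 -> L1}) :
    exists u v : F, [/\ phi y2 = u%:A + v%:A * y1, v != 0, a2 = a1 * v ^+ 2
      & a1 ^+ 2 * v ^+ 4 = a1 ^+ 2 * v ^+ 3 - u ^+ 3 - a1 * u * v ^+ 2].
  apply: cubic_root_affine charF gen1 _ _ => [s|].
    rewrite -(rmorph_alg phi) => /fmorph_inj; exact: cubic_gen_notin.
  by rewrite -rmorphXn -linearZ -(rmorph_alg phi) -!rmorphD Ey2 rmorph0.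
tfae.
- case/ext_iso_sym => phi phi_bij.
  have [u [v [Ephi nz_v _ Ev]]] := root_affine phi.
  (* Dividing [Ev] by a1 v^3 gives a1 v = a1 - u^3 / (a1 v^3) - u / v, which is [- beta] for w = - u
     / v and j = 1. *)
  exists (- (u / v)), 1%N; split=> // beta; exists phi => //.
  have Ebeta : - beta = a1 * v.
    have -> : a1 * v = (a1 ^+ 2 * v ^+ 4) / (a1 * v ^+ 3).
      by field; rewrite nz_a1 nz_v.
    by rewrite Ev /beta; field; rewrite nz_a1 nz_v.
  rewrite Ephi Ebeta scalerBr !scalerA -scaleN1r !scalerA mulr_algl addrC.
  by congr (_ *: _ + _ *: _); field; rewrite ?nz_a1 ?nz_v.
- case=> w [j [j12 /= [phi _ Ephi]]]; exists w, j; split=> //.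
  have [u [v [Euv _ -> _]]] := root_affine phi.
  set beta := (X in - X) in Ephi.
  (* The coefficients of [y1] in the two expressions of [phi y2] are compared. *)
  have Ev : v = - beta * (j%:R / a1).
    apply/eqP; rewrite -subr_eq0.
    have [|_ ->] // := @cubic_coord_eq0 _ _ y1
      (u + - beta * (a1^-1 * w)) (v - - beta * (j%:R / a1)) 0 gen1' dim1.
    move/eqP: Euv; rewrite Ephi -subr_eq0 => /eqP.
    rewrite !scale_in_algE; move/(congr1 -%R); rewrite oppr0 => <-.
    by ring.
  (* Both values of [j] square to 1 modulo 3, so a1 v^2 becomes beta^2 / a1. *)
  have j2 : j%:R ^+ 2 = 1 :> F.
    have nz_j : j%:R != 0 :> F.
      by rewrite -(dvdn_pcharf charF); move: j12; rewrite !inE => /orP[]/eqP->.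
    by apply: (mulIf nz_j); rewrite -exprSr expr3_pchar3_nat // mul1r.
  by rewrite Ev !exprMn j2 /beta; field.
- case=> w [j [_ Ea2]]; apply: ext_iso_sym.
  pose p : {poly F} := 'X^3 + (a2 *: 'X + (a2 ^+ 2)%:P).
  have hornerp (L : fieldExtType F) (z : L) :
      horner_alg z p = z ^+ 3 + a2 *: z + (a2 ^+ 2)%:A.
    rewrite /p -mul_polyC !(rmorphD, rmorphM) /= horner_algX !horner_algC.
    by rewrite mulr_algl addrA -!in_algE rmorphXn.
  (* The chosen root is the right-hand side of the formula for [y2] in (2), since [- beta] is (j
     a1^2 + w^3 + a1 w) / a1. *)
  have [||| phi _] := @lrmorphism_of_root F L2 L1 y2
    (((j%:R * a1 ^+ 2 + (w ^+ 3 + a1 * w)) / a1 ^+ 2)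
       *: (j%:R *: y1 - w%:A)) p gen2'.
  + rewrite dim2 size_polyDl size_polyXn // ltnS.
    rewrite (leq_trans (size_polyD _ _)) // geq_max.
    rewrite (leq_trans (size_scale_leq _ _)) ?size_polyX //=.
    by rewrite (leq_trans (size_polyC_leq1 _)).
  + by rewrite hornerp.
  + rewrite hornerp Ea2; apply: cubic_affine_root => //.
    exact: expr3_pchar3_nat.
  by exists phi; apply: lrmorphism_bij; rewrite dim1 dim2.
Qed.
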